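(* Let $\|\cdot\|$ be any norm on $\mathbb{R}^d$, let $r>0$, and let $\Omega:=\{\mathbf{x}\in\mathbb{R}^d:\|\mathbf{x}\|\le r\}$ be the ball of radius $r$ centered at the origin. Then $\Omega$ is a diagonally-determined set. If, in addition, the norm $\|\cdot\|$ is monotone, then the vector $\mathbf{v}$ in the definition of diagonally-determined may be chosen entrywise nonnegative, $\mathbf{v}\ge\mathbf{0}$.
   Context: $\langle\cdot,\cdot\rangle$ is the standard inner product on $\mathbb{R}^d$ and $\mathbf{1}=(1,\dots,1)\in\mathbb{R}^d$. For $\Omega\subset\mathbb{R}^d$, $\mathrm{diag}(\Omega)=\{t\in\mathbb{R}: t\mathbf{1}\in\Omega\}$. The set $\Omega$ is called diagonally-determined if (1) $\mathrm{diag}(\Omega)$ is an interval, say $[a,b]$, and (2) there exists $\mathbf{v}\in\mathbb{R}^d$ with $\langle\mathbf{v},\mathbf{1}\rangle=1$ and $\langle\mathbf{v},\mathbf{x}\rangle\in[a,b]$ for all $\mathbf{x}\in\Omega$. A norm $\|\cdot\|$ on $\mathbb{R}^d$ is called monotone if $\|\mathbf{x}\|\le\|\,|\mathbf{x}|\,\|$ for all $\mathbf{x}\in\mathbb{R}^d$, where $|\mathbf{x}|=(|x_1|,\dots,|x_d|)$. *)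

(* Defs.v *)
From HB Require Import structures.
From mathcomp Require Import all_boot all_order all_algebra.
From mathcomp Require Import all_classical all_reals.

Set Implicit Arguments.
Unset Strict Implicit.
Unset Printing Implicit Defensive.

Import Order.TTheory GRing.Theory Num.Theory.

Local Open Scope classical_set_scope.
Local Open Scope ring_scope.

(* Norms are plain functions rather than a normed structure on the carrier: the
   norm that MathComp-Analysis attaches to 'rV[R]_d is the sup norm. *)
Record is_norm (R : realType) (d : nat) (N : 'rV[R]_d -> R) : Prop := IsNorm {
  is_norm_ge0 : forall x, 0 <= N x ;
  is_norm_eq0 : forall x, N x = 0 -> x = 0 ;
  is_normZ : forall (a : R) x, N (a *: x) = `|a| * N x ;
  is_normD : forall x y, N (x + y) <= N x + N y }.

Definition absv (R : realType) (d : nat) (x : 'rV[R]_d) : 'rV[R]_d :=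
  \row_i `|x 0 i|.

Definition monotone_norm (R : realType) (d : nat) (N : 'rV[R]_d -> R) : Prop :=
  forall x, N x <= N (absv x).

Definition inner (R : realType) (d : nat) (x y : 'rV[R]_d) : R :=
  \sum_i x 0 i * y 0 i.

Definition onev (R : realType) (d : nat) : 'rV[R]_d := const_mx 1.
Arguments onev {R d}.

Definition diag (R : realType) (d : nat) (Omega : set 'rV[R]_d) : set R :=
  [set t | Omega (t *: onev)].

Definition determining_vector (R : realType) (d : nat) (Omega : set 'rV[R]_d)
    (a b : R) (v : 'rV[R]_d) : Prop :=
  inner v onev = 1 /\ forall x, Omega x -> inner v x \in `[a, b].

Definition diagonally_determined (R : realType) (d : nat)
    (Omega : set 'rV[R]_d) : Prop :=
  exists a b : R, [/\ a <= b, diag Omega = `[a, b]%classic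
    & exists v : 'rV[R]_d, determining_vector Omega a b v].

(* Main.v *)
Require Import Defs.
From mathcomp Require Import all_boot all_order all_algebra.
From mathcomp Require Import all_classical all_reals.
From mathcomp Require Import lra.

Import Order.TTheory GRing.Theory Num.Theory.

Local Open Scope classical_set_scope.
Local Open Scope ring_scope.

(** The diagonal of the ball is [- r / N 1, r / N 1], so a determining vector is
    the same thing as a linear form of norm at most 1 / N 1 taking the value 1
    at the all-ones vector: a norming functional, provided by the Hahn-Banach
    theorem ([hahn_banach_row]).

    The finite-dimensional Hahn-Banach theorem is obtained here without
    extending a form from subspace to subspace.  Instead the sublinear function
    itself is lowered: [tighten p e] is a sublinear function below p that is odd
    at e, and oddness at a vector survives further lowering.  Tightening first
    at the vector to be normed and then along a basis ends with a sublinear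
    function that is odd on a basis, and such a function is linear.

    For a monotone norm every determining vector v is automatically nonnegative:
    if s is the vector of signs of v, then |s| is the all-ones vector, so
    N s <= N 1 and the sum of the |v_i|, which is the pairing of v with s, is at
    most 1, the sum of the v_i. *)

Section Sublinear.
Set Implicit Arguments.
Unset Strict Implicit.
Variables (R : realType) (V : lmodType R).
Implicit Types (p q : V -> R) (x y e : V).

(** Homogeneity is asked as an inequality because that is what an infimum
    yields directly; [sublinearZ] recovers the equality. *)
Definition sublinear p : Prop :=
  (forall x y, p (x + y) <= p x + p y) /\
  (forall (a : R) x, 0 <= a -> p (a *: x) <= a * p x).

Lemma sublinear0 p : sublinear p -> p 0 = 0.
Proof.
move=> [pD pZ]; have := pZ 0 0 (lexx _); rewrite scale0r mul0r => p0_le0.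
have := pD 0 0; rewrite addr0; lra.
Qed.

Lemma sublinearZ p (a : R) x : sublinear p -> 0 <= a -> p (a *: x) = a * p x.
Proof.
move=> p_sub; rewrite le_eqVlt => /predU1P[<-|a_gt0].
  by rewrite scale0r mul0r sublinear0.
have [_ pZ] := p_sub; apply/le_anti; rewrite pZ ?(ltW a_gt0) //=.
have ai_ge0 : 0 <= a^-1 by rewrite invr_ge0 ltW.
have := pZ a^-1 (a *: x) ai_ge0.
by rewrite scalerA mulVf ?gt_eqF// scale1r mulrC ler_pdivlMr// mulrC.
Qed.

Lemma sublinear_oppr_ge p x : sublinear p -> - p x <= p (- x).
Proof.
move=> p_sub; have [pD _] := p_sub; have := pD x (- x).
by rewrite subrr sublinear0//; lra.
Qed.

(** A sublinear q <= p with q (- e) <= - p e satisfies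
    q x <= q (x + t e) + t q (- e) <= p (x + t e) - t p e for every t >= 0;
    the infimum of these bounds is the greatest such q. *)
Definition tighten p e x : R :=
  inf [set p (x + t *: e) - t * p e | t in [set t : R | 0 <= t]].

Section Tighten.
Variables (p : V -> R) (e : V).
Hypothesis p_sub : sublinear p.

Lemma tighten_le x (t : R) : 0 <= t -> tighten p e x <= p (x + t *: e) - t * p e.
Proof.
move=> t_ge0; apply: ge_inf; last by exists t.
(* subadditivity applied to t e = (x + t e) + (- x) bounds the set below *)
exists (- p (- x)) => _ /= [u u_ge0 <-].
have [pD _] := p_sub; have := pD (x + u *: e) (- x).
by rewrite addrAC subrr add0r sublinearZ//; lra.
Qed.

Lemma le_tighten x (c : R) :
  (forall t : R, 0 <= t -> c <= p (x + t *: e) - t * p e) -> c <= tighten p e x.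
Proof.
move=> c_le; apply: lb_le_inf.
  by exists (p (x + 0 *: e) - 0 * p e), 0 => //=.
by move=> _ /= [t t_ge0 <-]; exact: c_le.
Qed.

Lemma tighten_le_self x : tighten p e x <= p x.
Proof. by have := tighten_le x (lexx 0); rewrite scale0r mul0r addr0 subr0. Qed.

Lemma tightenN : tighten p e (- e) <= - p e.
Proof.
by have := tighten_le (- e) ler01; rewrite scale1r mul1r addNr sublinear0// sub0r.
Qed.

Lemma sublinear_tighten : sublinear (tighten p e).
Proof.
have [pD _] := p_sub; split=> [x y|a x].
  rewrite -lerBlDl; apply: le_tighten => t t_ge0.
  rewrite lerBlDr -lerBlDl; apply: le_tighten => u u_ge0.
  have := tighten_le (x + y) (addr_ge0 u_ge0 t_ge0).
  have := pD (x + u *: e) (y + t *: e).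
  by rewrite addrACA -scalerDl mulrDl; lra.
rewrite le_eqVlt => /predU1P[<-|a_gt0].
  by rewrite scale0r mul0r -(sublinear0 p_sub)// tighten_le_self.
rewrite mulrC -ler_pdivrMr//; apply: le_tighten => t t_ge0.
rewrite ler_pdivrMr// mulrC.
have := tighten_le (a *: x) (mulr_ge0 (ltW a_gt0) t_ge0).
by rewrite -scalerA -scalerDr (sublinearZ _ p_sub (ltW a_gt0)) -mulrA -mulrBr.
Qed.

End Tighten.

(** Oddness obtained at one vector is not lost when tightening at the next:
    q <= p and p (- x) <= - p x give q (- x) <= - p x <= - q x. *)
Lemma sublinear_odd_below p (s : seq V) : sublinear p ->
  exists q, [/\ sublinear q, forall x, q x <= p x &
    forall e, e \in s -> q (- e) = - q e].
Proof.
elim: s p => [|e s IH] p p_sub; first by exists p; split.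
have [q [q_sub q_le q_odd]] := IH _ (sublinear_tighten e p_sub).
exists q; split=> // [x|f].
  exact: le_trans (q_le x) (tighten_le_self e p_sub x).
rewrite inE => /predU1P[->|/q_odd//].
apply/le_anti; rewrite sublinear_oppr_ge// andbT.
apply: le_trans (q_le _) (le_trans (tightenN e p_sub) _).
by rewrite lerN2 (le_trans (q_le e))// tighten_le_self.
Qed.

End Sublinear.

Section RowVectors.
Set Implicit Arguments.
Unset Strict Implicit.
Variables (R : realType) (d : nat).
Implicit Types (v x y : 'rV[R]_d) (N : 'rV[R]_d -> R).

Lemma innerNr v x : inner v (- x) = - inner v x.
Proof. by rewrite /inner -sumrN; apply: eq_bigr => i _; rewrite mxE mulrN. Qed.

(** Subadditivity makes q at most the linear form with the same values on the
    basis; the same bound at - x, with the oddness of the form, is the reverse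
    inequality. *)
Lemma sublinear_odd_inner (q : 'rV[R]_d -> R) : sublinear q ->
  (forall i, q (- delta_mx 0 i) = - q (delta_mx 0 i)) ->
  forall x, q x = inner (\row_i q (delta_mx 0 i)) x.
Proof.
move=> q_sub q_odd; set v := \row_i _.
have q_line (a : R) i : q (a *: delta_mx 0 i) = a * q (delta_mx 0 i).
  have [a_ge0|a_lt0] := leP 0 a; first exact: sublinearZ.
  by rewrite -[a]opprK scaleNr -scalerN sublinearZ ?q_odd ?mulrN ?mulNr//; lra.
have q_le x : q x <= inner v x.
  rewrite {1}[x]row_sum_delta.
  elim/big_rec2: (inner v x) => [|i b y _ qy_le]; first by rewrite sublinear0.
  have [qD _] := q_sub; apply: le_trans (qD _ _) _.
  by rewrite q_line [v 0 i]mxE [x 0 i * _]mulrC lerD2l.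
move=> x; apply/le_anti; rewrite q_le /=.
have := q_le (- x); have := sublinear_oppr_ge x q_sub.
by rewrite innerNr; lra.
Qed.

(** Tightening once at e forces every sublinear function below to take at e the
    value p e, the largest one possible. *)
Lemma hahn_banach_row (p : 'rV[R]_d -> R) (e : 'rV[R]_d) : sublinear p ->
  exists v, inner v e = p e /\ forall x, inner v x <= p x.
Proof.
move=> p_sub.
have [q [q_sub q_le q_odd]] :=
  sublinear_odd_below [seq delta_mx 0 i | i : 'I_d] (sublinear_tighten e p_sub).
have qE := sublinear_odd_inner q_sub (fun i => q_odd _ (codom_f _ i)).
exists (\row_i q (delta_mx 0 i)).
have v_le x : inner (\row_i q (delta_mx 0 i)) x <= p x.
  by rewrite -qE (le_trans (q_le x))// tighten_le_self.
split=> //; apply/le_anti; rewrite v_le /=.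
have := le_trans (q_le (- e)) (tightenN e p_sub).
by rewrite qE innerNr lerN2.
Qed.

Lemma is_normN N x : is_norm N -> N (- x) = N x.
Proof. by move=> N_norm; rewrite -scaleN1r is_normZ// normrN1 mul1r. Qed.

Lemma is_norm_onev_gt0 N : (0 < d)%N -> is_norm N -> 0 < N onev.
Proof.
move=> d_gt0 N_norm; rewrite lt_neqAle is_norm_ge0// andbT eq_sym.
apply/eqP => /(is_norm_eq0 N_norm) /rowP /(_ (Ordinal d_gt0)).
by rewrite !mxE => /eqP; rewrite oner_eq0.
Qed.

Lemma sublinear_norm_div N (c : R) : is_norm N -> 0 < c ->
  sublinear (fun x => N x / c).
Proof.
move=> N_norm c_gt0; split=> [x y|a x a_ge0].
  by rewrite -mulrDl ler_pM2r ?invr_gt0// is_normD.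
by rewrite is_normZ// ger0_norm// mulrA.
Qed.

Lemma diag_ball N (r : R) : is_norm N -> 0 < N onev ->
  diag [set x | N x <= r] = `[- (r / N onev), r / N onev]%classic.
Proof.
move=> N_norm N1_gt0; apply/seteqP; split=> t; rewrite /diag /=;
  by rewrite in_itv /= -ler_norml is_normZ// ler_pdivlMr.
Qed.

(** Pairing v with its own sign vector s gives the sum of the |v_i|, while
    N s <= N |s| = N 1. *)
Lemma monotone_norming_ge0 N v : monotone_norm N -> 0 < N onev ->
  inner v onev = 1 -> (forall x, inner v x <= N x / N onev) ->
  forall i, 0 <= v 0 i.
Proof.
move=> N_mono N1_gt0 v1 v_le.
pose s : 'rV[R]_d := \row_i (if v 0 i < 0 then -1 else 1).
have abs_s : absv s = onev.
  by apply/rowP => i; rewrite !mxE; case: ifP; rewrite ?normrN1 ?normr1.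
have vs_le1 : inner v s <= 1.
  by rewrite (le_trans (v_le s))// ler_pdivrMr// mul1r -abs_s N_mono.
have sum_le0 : \sum_i (`|v 0 i| - v 0 i) <= 0.
  rewrite sumrB subr_le0.
  have -> : \sum_i v 0 i = 1.
    by rewrite -v1; apply: eq_bigr => i _; rewrite mxE mulr1.
  have <- // : inner v s = \sum_i `|v 0 i|.
  apply: eq_bigr => i _; rewrite mxE.
  by case: ltP => vi; rewrite ?mulrN1 ?mulr1; [rewrite ltr0_norm|rewrite ger0_norm].
move=> i; have term_ge0 j : true -> 0 <= `|v 0 j| - v 0 j.
  by rewrite subr_ge0 ler_norm.
have /eqP := le_anti (introT andP (conj sum_le0 (sumr_ge0 _ term_ge0))).
rewrite psumr_eq0 // => /allP /(_ i (mem_index_enum i)) /=.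
by rewrite subr_eq0 => /eqP <-.
Qed.

End RowVectors.

Theorem proposition2p5 (R : realType) (d : nat) (d_gt0 : (0 < d)%N)
    (N : 'rV[R]_d -> R) (N_norm : is_norm N) (r : R) (r_gt0 : 0 < r) :
  let Omega : set 'rV[R]_d := [set x | N x <= r] in
  diagonally_determined Omega /\
  (monotone_norm N ->
   exists a b : R, [/\ a <= b, diag Omega = `[a, b]%classic
     & exists v : 'rV[R]_d,
         determining_vector Omega a b v /\ (forall i, 0 <= v 0 i)]).
Proof.
move=> Omega.
have N1_gt0 := is_norm_onev_gt0 d_gt0 N_norm.
have [v [v1 v_le]] :=
  hahn_banach_row onev (sublinear_norm_div N_norm N1_gt0).
rewrite divff ?gt_eqF// in v1.
have v_det : determining_vector Omega (- (r / N onev)) (r / N onev) v.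
  split=> // x Nx_le; have N1i_gt0 : 0 < (N onev)^-1 by rewrite invr_gt0.
  have Nx_div : N x / N onev <= r / N onev by rewrite ler_pM2r.
  rewrite in_itv /= (le_trans (v_le x) Nx_div) andbT lerNl -innerNr.
  by rewrite (le_trans (v_le _))// is_normN.
have le_ab : - (r / N onev) <= r / N onev.
  by rewrite ge0_cp// divr_ge0 ?ltW.
have diagE := diag_ball r N_norm N1_gt0.
split; first by exists (- (r / N onev)), (r / N onev); split=> //; exists v.
move=> N_mono; exists (- (r / N onev)), (r / N onev); split=> //.
by exists v; split=> //; exact: monotone_norming_ge0 v1 v_le.
Qed.
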